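(* Let $A \in \mathbb{R}^{m \times n}$ with $\operatorname{rank}(A) = \rho$, and let $0<r<\rho$ and $0<k<n$ be integers. Let $\mathcal{M}$ be a column-selection algorithm that returns linearly independent columns, and suppose $C \in \mathbb{R}^{m \times r}$ is the output of CVOD+CSSP (respectively adaptCVOD+CSSP) applied to $A$ with target rank $r$, initial number of Voronoi sets $k$ and column-selection algorithm $\mathcal{M}$. Let $\{(V_i,\hat U_i)\}_i$ be the Voronoi sets and centroids at termination of the partitioning algorithm, with centroid dimensions $d_i=\operatorname{rank}(\hat U_i)$, let $C_i$ be the submatrix of $C$ consisting of the columns selected from $V_i$, and set $$L^* = \sup_i \left\lceil \frac{r}{d_i}\right\rceil,\qquad \zeta = \max_i\left(1+\|C_i^\dagger\|_2\,\|V_i\|_2\right).$$ Then $$\|(I_m - CC^\dagger)A\|_F \le \zeta \left (\|A - A_r\|_F^2 + \left (1 - \frac{1}{L^*}\right )\|A_r\|_F^2 \right )^{1/2},$$ where $A_r$ is the best rank-$r$ approximation to $A$ given by the truncated SVD.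
   Context: Notation: $C^\dagger$ is the Moore-Penrose pseudoinverse, $\|\cdot\|_2$ the spectral norm (Euclidean norm on vectors), $\|\cdot\|_F$ the Frobenius norm, $\lceil\cdot\rceil$ the ceiling. A set of columns of $A$ (columns counted with their index) is identified with the matrix having these columns; $V(:,\mathcal J)$ is the submatrix of $V$ with column indices $\mathcal J$. Partitioning algorithms. Both produce a partition $\{V_i\}$ of the columns of $A$ (''Voronoi sets'') and matrices $\hat U_i\in\mathbb{R}^{m\times d_i}$ with orthonormal columns (''centroids''), $d_i\ge 1$, $\sum_i d_i=r$. CVOD: the input is $A$, integers $r,k$, positive integers $d_1,\dots,d_k$ with $\sum_i d_i=r$, and a tolerance $\epsilon>0$. Start with a random partition $\{V_i\}_{i=1}^k$ of the columns of $A$. Repeat: (1) let $\hat U_i$ have as columns the top $d_i$ left singular vectors of $V_i$; (2) reassign each column $x$ of $A$ to the set $V_i$ for which $\|(I_m-\hat U_i\hat U_i^T)x\|_2^2$ is smallest (ties go to the smallest index); stop when the decrease of the energy $\sum_i\sum_{x\in V_i}\|(I_m-\hat U_i\hat U_i^T)x\|_2^2$ between consecutive iterations is at most $\epsilon$. adaptCVOD: same as CVOD, but without prescribed $d_i$; in step (1) one takes the $r$ largest singular values of the block-diagonal matrix $\operatorname{diag}(V_1,\dots,V_k)$ (i.e. the $r$ largest among all singular values of all the $V_i$), and $\hat U_i$ consists of the left singular vectors of $V_i$ corresponding to those of the selected singular values that belong to $V_i$; $d_i$ is their number, so $\hat U_i$ contains the top $d_i$ left singular vectors of $V_i$. Indices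 with $d_i=0$ are discarded (the number of Voronoi sets is reduced accordingly), and then step (2) is performed with the remaining centroids. At termination, $\hat U_i$ is taken to be the centroid of $V_i$, i.e. the matrix whose columns are the top $d_i$ left singular vectors of the final $V_i$. Column-selection algorithm returning linearly independent columns: a map $\mathcal{M}$ which, given a matrix $B$ and an integer $0<d\le\operatorname{rank}(B)$, returns a set $\mathcal J=\mathcal M(B,d)$ of $d$ column indices of $B$ such that the columns of $B(:,\mathcal J)$ are linearly independent. PartitionedCSSP: given the final $\{(V_i,\hat U_i)\}$ and $\mathcal M$, reorder so that $d_1\le d_2\le\cdots$. Set $C_1=V_1(:,\mathcal M(V_1,d_1))$ and $C=C_1$. For $i=2,3,\dots$: put $\tilde V_i=(I_m-CC^\dagger)V_i$, $\mathcal J_i=\mathcal M(\tilde V_i,d_i)$, $C_i=V_i(:,\mathcal J_i)$, and replace $C$ by $[C_1\ \cdots\ C_i]$. Return $C$. That the output is $C\in\mathbb{R}^{m\times r}$ means that every call selected $d_i$ columns. CVOD+CSSP (adaptCVOD+CSSP) means running CVOD (adaptCVOD) to completion and then PartitionedCSSP on its output. *)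

(* Defs.v *)
From HB Require Import structures.
From mathcomp Require Import all_boot all_order all_algebra.
From mathcomp Require Import boolp classical_sets reals.

Set Implicit Arguments.
Unset Strict Implicit.
Unset Printing Implicit Defensive.

Import Order.TTheory GRing.Theory Num.Theory.

Local Open Scope ring_scope.

Section LinearAlgebra.
Context {R : realType}.

(* On column vectors this is the Euclidean norm. *)
Definition frobenius m n (B : 'M[R]_(m, n)) : R :=
  Num.sqrt (\sum_i \sum_j B i j ^+ 2).

Definition spectral_norm m n (B : 'M[R]_(m, n)) : R :=
  sup [set frobenius (B *m x) | x in [set x : 'cV[R]_n | frobenius x <= 1]]%classic.

Definition penrose m n (B : 'M[R]_(m, n)) (X : 'M[R]_(n, m)) : Prop :=
  [/\ B *m X *m B = B, X *m B *m X = X,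
      (B *m X)^T = B *m X & (X *m B)^T = X *m B].

(* The four Penrose equations have exactly one solution, so the default value
   0 is never used. *)
Definition pinv m n (B : 'M[R]_(m, n)) : 'M[R]_(n, m) :=
  xget 0 [set X | penrose B X]%classic.

Definition rect_diag m n (s : nat -> R) : 'M[R]_(m, n) :=
  \matrix_(i, j) if i == j :> nat then s i else 0.

(* Full singular value decomposition. The singular values are
   s 0 >= s 1 >= ... >= s (minn m n).-1; further values of s are irrelevant. *)
Definition is_svd m n (B : 'M[R]_(m, n)) (U : 'M[R]_m) (s : nat -> R)
    (W : 'M[R]_n) : Prop :=
  [/\ U^T *m U = 1%:M, W^T *m W = 1%:M,
      forall i j, (i <= j < minn m n)%N -> 0 <= s j <= s i &
      B = U *m rect_diag m n s *m W^T].

(* A relation, since singular vectors are not unique. *)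
Definition top_left_sv m n (B : 'M[R]_(m, n)) d (Q : 'M[R]_(m, d)) : Prop :=
  exists (U : 'M[R]_m) (s : nat -> R) (W : 'M[R]_n) (led : (d <= m)%N),
    is_svd B U s W /\ Q = colsub (widen_ord led) U.

Definition truncated_svd r m n (B Br : 'M[R]_(m, n)) : Prop :=
  exists (U : 'M[R]_m) (s : nat -> R) (W : 'M[R]_n), is_svd B U s W /\
    Br = U *m rect_diag m n (fun j => if (j < r)%N then s j else 0) *m W^T.

(* A set of columns is handled through the list of its column indices. *)
Definition cols m n (B : 'M[R]_(m, n)) (l : seq 'I_n) : 'M[R]_(m, size l) :=
  colsub (tnth (in_tuple l)) B.

End LinearAlgebra.

Section Partitioning.
Context {R : realType} {m n k : nat}.
Variable A : 'M[R]_(m, n).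

(* The Voronoi sets are encoded by the map f sending each column index of A to
   the index of its set; sets may be empty. *)
Definition voronoi_idx (f : 'I_n -> 'I_k) (i : 'I_k) : seq 'I_n :=
  enum [pred j | f j == i].

Definition voronoi (f : 'I_n -> 'I_k) (i : 'I_k) :
  'M[R]_(m, size (voronoi_idx f i)) := cols A (voronoi_idx f i).

(* Discarded indices are not renumbered away: they are the i with cdim i = 0.
   Columns are only ever assigned to the other indices, and the empty Voronoi
   set of a discarded index has no singular values, so that in adaptCVOD such an
   index stays discarded. *)
Record centroids := Centroids {
  cdim : 'I_k -> nat;
  centroid : forall i, 'M[R]_(m, cdim i) }.

Definition dist2 (c : centroids) (i : 'I_k) (x : 'I_n) : R :=
  frobenius ((1%:M - centroid c i *m (centroid c i)^T) *m col x A) ^+ 2.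

Definition energy (c : centroids) (f : 'I_n -> 'I_k) : R :=
  \sum_i \sum_(x | f x == i) dist2 c i x.

Definition are_centroids (f : 'I_n -> 'I_k) (c : centroids) : Prop :=
  forall i, top_left_sv (voronoi f i) (centroid c i).

Definition reassigned (c : centroids) (f : 'I_n -> 'I_k) : Prop :=
  forall x, (0 < cdim c (f x))%N /\
    forall i, (0 < cdim c i)%N ->
      dist2 c (f x) x < dist2 c i x \/
      dist2 c (f x) x = dist2 c i x /\ (f x <= i)%N.

(* Iteration t.+1 computes cs t.+1 from fs t, and then fs t.+1. The energies of
   two consecutive iterations are first available after two iterations; the run
   consists of T.+2 iterations. *)
Definition iterates_to (step : ('I_n -> 'I_k) -> centroids -> Prop) (eps : R)
    (f : 'I_n -> 'I_k) (c : centroids) : Prop :=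
  exists (T : nat) (fs : nat -> 'I_n -> 'I_k) (cs : nat -> centroids),
    let decrease t := energy (cs t.+1) (fs t.+1) - energy (cs t.+2) (fs t.+2) in
    [/\ forall t, (t < T.+2)%N ->
          step (fs t) (cs t.+1) /\ reassigned (cs t.+1) (fs t.+1),
        forall t, (t < T)%N -> eps < decrease t,
        decrease T <= eps,
        f = fs T.+2 &
        cdim c =1 cdim (cs T.+2) /\ are_centroids f c].

Definition cvod_output (r : nat) (d : 'I_k -> nat) (eps : R)
    (f : 'I_n -> 'I_k) (c : centroids) : Prop :=
  [/\ 0 < eps, forall i, (0 < d i)%N, (\sum_i d i)%N = r &
      iterates_to (fun f c => cdim c =1 d /\ are_centroids f c) eps f c].

(* d i is the number of singular values of V_i in a selection S of r largest
   ones among the singular values of all the V_i; (i, j) in S stands for the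
   singular value of index j of V_i. *)
Definition adapt_dims (r : nat) (f : 'I_n -> 'I_k) (d : 'I_k -> nat) : Prop :=
  exists (sv : 'I_k -> nat -> R) (S : {set 'I_k * 'I_n}),
    let sv_idx := [set p : 'I_k * 'I_n |
                    (p.2 < minn m (size (voronoi_idx f p.1)))%N] in
    [/\ forall i, exists U W, is_svd (voronoi f i) U (sv i) W,
        S \subset sv_idx,
        #|S| = r,
        forall p q, p \in S -> q \in sv_idx :\: S -> sv q.1 q.2 <= sv p.1 p.2 &
        forall i, d i = #|[set j | (i, j) \in S]|].

Definition adapt_cvod_output (r : nat) (eps : R)
    (f : 'I_n -> 'I_k) (c : centroids) : Prop :=
  0 < eps /\
  iterates_to (fun f c => adapt_dims r f (cdim c) /\ are_centroids f c) eps f c.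

End Partitioning.

Arguments centroids : clear implicits.

Section ColumnSelection.
Context {R : realType}.

Definition col_selector := forall m n, 'M[R]_(m, n) -> nat -> {set 'I_n}.

(* Values of M outside the range 0 < d <= \rank B are irrelevant. *)
Definition selects_independent (M : col_selector) : Prop :=
  forall m n (B : 'M[R]_(m, n)) d, (0 < d <= \rank B)%N ->
    #|M m n B d| = d /\ row_free (cols B (enum (M m n B d)))^T.

(* s is the processing order, and J i lists the indices, as columns of A, of the
   columns selected from V_i. The matrix C at the beginning of step t consists
   of the columns selected from the first t Voronoi sets of s; for t = 0 it has
   no columns, so that Vt is the first Voronoi set itself. *)
Definition partitioned_cssp (M : col_selector) m n k r (A : 'M[R]_(m, n))
    (f : 'I_n -> 'I_k) (c : centroids R m k) (J : 'I_k -> seq 'I_n)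
    (C : 'M[R]_(m, r)) : Prop :=
  exists (s : seq 'I_k) (l : r.-tuple 'I_n),
    [/\ uniq s, s =i [pred i | (0 < cdim c i)%N],
        sorted leq [seq cdim c i | i <- s],
        forall (t : nat) (i : 'I_k), onth s t = Some i ->
          let Ct := cols A (flatten [seq J j | j <- take t s]) in
          let Vt := (1%:M - Ct *m pinv Ct) *m voronoi A f i in
          (0 < cdim c i <= \rank Vt)%N /\
          J i = [seq tnth (in_tuple (voronoi_idx f i)) j
                | j <- enum (M _ _ Vt (cdim c i))] &
        l = flatten [seq J i | i <- s] :> seq 'I_n /\ C = colsub (tnth l) A].

End ColumnSelection.

Arguments col_selector : clear implicits.

(* Main.v *)
Require Import Defs.
From HB Require Import structures.
From mathcomp Require Import all_boot all_order all_algebra.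
From mathcomp Require Import boolp classical_sets reals.
From mathcomp Require Import ring lra.

Set Implicit Arguments.
Unset Strict Implicit.
Unset Printing Implicit Defensive.

Import Order.TTheory GRing.Theory Num.Theory.

Local Open Scope ring_scope.

(** Write [P = C C^+], [P_i = C_i C_i^+] and [Q_i = U_i U_i^T], where [U_i] is
    the centroid of the Voronoi set [V_i]. The bound splits into a column
    selection estimate on each [V_i] and an estimate of the final energy
    [\sum_i |(1 - Q_i) V_i|^2].

    Column selection. The columns of [C_i] lie in the range of [C], so
    [|(1 - P) V_i| <= |(1 - P_i) V_i|]. Decompose
    [(1 - P_i) V_i = (1 - P_i) (1 - Q_i) V_i + (1 - P_i) Q_i V_i].
    The first term is at most [|(1 - Q_i) V_i|]. For the second one, [P_i] and
    [Q_i] are orthogonal projectors of the same rank [d_i], because the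
    selected columns are independent; for two such projectors
    [|(1 - P_i) Q_i|^2 = d_i - \tr (P_i Q_i) = |(1 - Q_i) P_i|^2]
    ([ler_frobenius_proj_swap]). Finally
    [(1 - Q_i) P_i = ((1 - Q_i) C_i) C_i^+], where [(1 - Q_i) C_i] consists of
    columns of [(1 - Q_i) V_i]. This gives the factor
    [1 + |C_i^+|_2 |V_i|_2] ([css_projection_error]).

    Energy. Let [Pi] be the projector onto the span of the [r] leading left
    singular vectors of [A], so that [A_r = Pi A]. In a basis of left singular
    vectors of [V_i], [|Pi V_i|^2] is a weighted sum of the squared singular
    values of [V_i], the weights being the diagonal entries of a projector of
    trace [r]: they lie in [[0, 1]] and sum to [r <= L d_i]. Such a sum is
    at most [L] times the sum of the [d_i] largest squares, which is
    [L |Q_i V_i|^2] ([ler_frobenius_sqr_top]). Summing over [i],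
    [|A_r|^2 <= L \sum_i |Q_i V_i|^2], and Pythagoras yields the stated bound.

    Both partitioning algorithms enter through two facts about their final state:
    the centroids are leading left singular vectors of the Voronoi sets, and no
    column is assigned to a discarded index ([iterates_to_covered]). *)

(** * The Frobenius and spectral norms *)

Section Frobenius.
Context {R : realType}.

Lemma frobenius_ge0 m n (B : 'M[R]_(m, n)) : 0 <= frobenius B.
Proof. exact: sqrtr_ge0. Qed.

Lemma frobenius_sqrE m n (B : 'M[R]_(m, n)) :
  frobenius B ^+ 2 = \sum_i \sum_j B i j ^+ 2.
Proof.
by rewrite sqr_sqrtr //; do 2! (apply: sumr_ge0 => ? _); exact: sqr_ge0.
Qed.

Lemma frobenius_sqr m n (B : 'M[R]_(m, n)) :
  frobenius B ^+ 2 = \tr (B^T *m B).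
Proof.
rewrite frobenius_sqrE exchange_big; apply: eq_bigr => j _; rewrite mxE.
by apply: eq_bigr => i _; rewrite mxE expr2.
Qed.

Lemma frobenius_trmx m n (B : 'M[R]_(m, n)) : frobenius B^T = frobenius B.
Proof.
rewrite /frobenius exchange_big; congr Num.sqrt.
by do 2! (apply: eq_bigr => ? _); rewrite mxE.
Qed.

Lemma frobenius_eq0 m n (B : 'M[R]_(m, n)) : frobenius B = 0 -> B = 0.
Proof.
move=> B0; have := frobenius_sqrE B; rewrite B0 expr0n => /esym/eqP.
rewrite psumr_eq0 => [/allP Bi0|i _]; last first.
  by apply: sumr_ge0 => j _; apply: sqr_ge0.
apply/matrixP=> i j; rewrite mxE; have := Bi0 i (mem_index_enum _).
rewrite /= psumr_eq0 => [/allP/(_ j (mem_index_enum _))|? _].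
  by rewrite /= sqrf_eq0 => /eqP.
exact: sqr_ge0.
Qed.

Lemma frobenius0 m n : frobenius (0 : 'M[R]_(m, n)) = 0.
Proof. by apply/eqP; rewrite -sqrf_eq0 frobenius_sqr mulmx0 mxtrace0. Qed.

Lemma frobenius_sqrDZ m n (X Y : 'M[R]_(m, n)) a b :
  frobenius (a *: X + b *: Y) ^+ 2 =
  a ^+ 2 * frobenius X ^+ 2 + 2 * a * b * \tr (X^T *m Y)
  + b ^+ 2 * frobenius Y ^+ 2.
Proof.
have trD (U V : 'M[R]_(m, n)) : (U + V)^T = U^T + V^T by rewrite linearD.
have trZ u (U : 'M[R]_(m, n)) : (u *: U)^T = u *: U^T by rewrite linearZ.
rewrite !frobenius_sqr trD !trZ mulmxDl !mulmxDr.
rewrite -!scalemxAl -!scalemxAr !mxtraceD !mxtraceZ.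
by rewrite -[\tr (Y^T *m X)]mxtrace_tr trmx_mul trmxK; ring.
Qed.

Lemma frobeniusZ m n (X : 'M[R]_(m, n)) a :
  0 <= a -> frobenius (a *: X) = a * frobenius X.
Proof.
move=> a0; apply/eqP.
rewrite -(@eqrXn2 _ 2) ?mulr_ge0 ?frobenius_ge0 //.
by rewrite exprMn !frobenius_sqr [(a *: X)^T]linearZ /=
  -scalemxAl -scalemxAr !mxtraceZ expr2 mulrA.
Qed.

(** Expand the nonnegative square [| |Y| X - |X| Y |^2]. *)
Lemma mxtrace_CauchySchwarz m n (X Y : 'M[R]_(m, n)) :
  \tr (X^T *m Y) <= frobenius X * frobenius Y.
Proof.
have [X0|X_neq0] := eqVneq (frobenius X) 0.
  by rewrite X0 mul0r (frobenius_eq0 X0) trmx0 mul0mx mxtrace0.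
have [Y0|Y_neq0] := eqVneq (frobenius Y) 0.
  by rewrite Y0 mulr0 (frobenius_eq0 Y0) mulmx0 mxtrace0.
have X_gt0 : 0 < frobenius X by rewrite lt0r X_neq0 frobenius_ge0.
have Y_gt0 : 0 < frobenius Y by rewrite lt0r Y_neq0 frobenius_ge0.
have := sqr_ge0 (frobenius (frobenius Y *: X + (- frobenius X) *: Y)).
rewrite frobenius_sqrDZ; move: (\tr _) => t h.
rewrite -(ler_pM2l (mulr_gt0 X_gt0 Y_gt0)); lra.
Qed.

Lemma ler_frobeniusD m n (X Y : 'M[R]_(m, n)) :
  frobenius (X + Y) <= frobenius X + frobenius Y.
Proof.
rewrite -(@ler_pXn2r _ 2) ?nnegrE ?addr_ge0 ?frobenius_ge0 //.
have := frobenius_sqrDZ X Y 1 1; rewrite !scale1r => ->.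
by have := mxtrace_CauchySchwarz X Y; lra.
Qed.

Lemma frobenius_outer m n (y : 'cV[R]_m) (x : 'cV[R]_n) :
  frobenius (y *m x^T) = frobenius y * frobenius x.
Proof.
apply/eqP; rewrite -(@eqrXn2 _ 2) ?mulr_ge0 ?frobenius_ge0 //; apply/eqP.
rewrite exprMn !frobenius_sqrE big_distrl; apply: eq_bigr => i _ /=.
rewrite big_ord1 big_distrr; apply: eq_bigr => j _ /=.
by rewrite mxE !big_ord1 mxE exprMn.
Qed.

(** Cauchy-Schwarz for [B] and the rank-one matrix [B x x^T]: their inner product
    is [|B x|^2]. Only serves to show that the supremum defining the spectral
    norm is finite. *)
Lemma ler_frobenius_mulv m n (B : 'M[R]_(m, n)) (x : 'cV[R]_n) :
  frobenius (B *m x) <= frobenius B * frobenius x.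
Proof.
have [->|Bx_neq0] := eqVneq (frobenius (B *m x)) 0.
  by rewrite mulr_ge0 ?frobenius_ge0.
have Bx_gt0 : 0 < frobenius (B *m x) by rewrite lt0r Bx_neq0 frobenius_ge0.
have := mxtrace_CauchySchwarz B (B *m x *m x^T).
rewrite frobenius_outer mulmxA mxtrace_mulC (mulmxA x^T) -trmx_mul
  -frobenius_sqr.
by rewrite expr2 mulrCA -subr_ge0 -mulrBr pmulr_rge0 // subr_ge0.
Qed.

Lemma spectral_norm_ub m n (B : 'M[R]_(m, n)) :
  has_ubound [set frobenius (B *m x) | x in
               [set x : 'cV[R]_n | frobenius x <= 1]]%classic.
Proof.
exists (frobenius B) => _ [x /= x1 <-].
by rewrite (le_trans (ler_frobenius_mulv _ _)) // ler_piMr ?frobenius_ge0.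
Qed.

Lemma spectral_norm_ge0 m n (B : 'M[R]_(m, n)) : 0 <= spectral_norm B.
Proof.
apply: (ub_le_sup (spectral_norm_ub B)).
by exists 0; rewrite /= ?mulmx0 frobenius0.
Qed.

Lemma ler_spectral_norm_mulv m n (B : 'M[R]_(m, n)) (x : 'cV[R]_n) :
  frobenius (B *m x) <= spectral_norm B * frobenius x.
Proof.
have [x0|x_neq0] := eqVneq (frobenius x) 0.
  by rewrite x0 mulr0 (frobenius_eq0 x0) mulmx0 frobenius0.
have x_gt0 : 0 < frobenius x by rewrite lt0r x_neq0 frobenius_ge0.
rewrite -ler_pdivrMr // mulrC -frobeniusZ ?invr_ge0 ?frobenius_ge0 //.
rewrite scalemxAr; apply: (ub_le_sup (spectral_norm_ub B)).
exists ((frobenius x)^-1 *: x) => //=.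
by rewrite frobeniusZ ?invr_ge0 ?frobenius_ge0 // mulVf.
Qed.

Lemma frobenius_sqr_col m n (B : 'M[R]_(m, n)) :
  frobenius B ^+ 2 = \sum_j frobenius (col j B) ^+ 2.
Proof.
rewrite frobenius_sqrE exchange_big; apply: eq_bigr => j _ /=.
rewrite frobenius_sqrE; apply: eq_bigr => i _.
by rewrite big_ord1 mxE.
Qed.

Lemma ler_frobenius_mul_cols m n p (B : 'M[R]_(m, n)) (X : 'M[R]_(n, p)) b :
  0 <= b -> (forall x : 'cV_n, frobenius (B *m x) <= b * frobenius x) ->
  frobenius (B *m X) <= b * frobenius X.
Proof.
move=> b0 Bb.
rewrite -(@ler_pXn2r _ 2) ?nnegrE ?mulr_ge0 ?frobenius_ge0 // exprMn.
rewrite !frobenius_sqr_col mulr_sumr; apply: ler_sum => j _.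
rewrite -exprMn ler_pXn2r ?nnegrE ?mulr_ge0 ?frobenius_ge0 //.
by rewrite colE -mulmxA -colE.
Qed.

(** The spectral norm also bounds the transpose: by Cauchy-Schwarz
    [|B^T y|^2 = <y, B (B^T y)> <= |y| |B|_2 |B^T y|]. *)
Lemma ler_spectral_norm_trmulv m n (B : 'M[R]_(m, n)) (y : 'cV[R]_m) :
  frobenius (B^T *m y) <= spectral_norm B * frobenius y.
Proof.
have [->|Ny_neq0] := eqVneq (frobenius (B^T *m y)) 0.
  by rewrite mulr_ge0 ?frobenius_ge0 ?spectral_norm_ge0.
have Ny_gt0 : 0 < frobenius (B^T *m y) by rewrite lt0r Ny_neq0 frobenius_ge0.
rewrite -(ler_pM2r Ny_gt0) -expr2 frobenius_sqr trmx_mul trmxK -mulmxA.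
apply: le_trans (mxtrace_CauchySchwarz _ _) _.
rewrite [leRHS]mulrAC [leRHS]mulrC ler_wpM2l ?frobenius_ge0 //.
exact: ler_spectral_norm_mulv.
Qed.

Lemma ler_frobenius_mulr m n p (X : 'M[R]_(p, m)) (B : 'M[R]_(m, n)) :
  frobenius (X *m B) <= frobenius X * spectral_norm B.
Proof.
rewrite -frobenius_trmx trmx_mul -(frobenius_trmx X) mulrC.
apply: ler_frobenius_mul_cols; first exact: spectral_norm_ge0.
exact: ler_spectral_norm_trmulv.
Qed.

End Frobenius.

(** * Orthogonal projectors and the pseudoinverse *)

Section Projectors.
Context {R : realType}.

Definition orthoproj m (P : 'M[R]_m) := P^T = P /\ P *m P = P.

Lemma orthoprojC m (P : 'M[R]_m) : orthoproj P -> orthoproj (1%:M - P).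
Proof.
move=> [PT PP]; split; first by rewrite linearB /= trmx1 PT.
by rewrite mulmxBl mul1mx mulmxBr mulmx1 PP subrr subr0.
Qed.

Lemma frobenius_sqr_proj m n (P : 'M[R]_m) (B : 'M[R]_(m, n)) :
  orthoproj P -> frobenius (P *m B) ^+ 2 = \tr (P *m (B *m B^T)).
Proof.
move=> [PT PP]; rewrite frobenius_sqr trmx_mul PT mulmxA -(mulmxA B^T P P) PP.
by rewrite -mulmxA mxtrace_mulC -mulmxA.
Qed.

Lemma frobenius_pythagoras m n (P : 'M[R]_m) (B : 'M[R]_(m, n)) :
  orthoproj P ->
  frobenius ((1%:M - P) *m B) ^+ 2 = frobenius B ^+ 2 - frobenius (P *m B) ^+ 2.
Proof.
move=> Pp; rewrite !frobenius_sqr_proj //; last exact: orthoprojC.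
by rewrite mulmxBl mul1mx linearB /= frobenius_sqr mxtrace_mulC.
Qed.

Lemma ler_frobenius_proj m n (P : 'M[R]_m) (B : 'M[R]_(m, n)) :
  orthoproj P -> frobenius (P *m B) <= frobenius B.
Proof.
move=> Pp; rewrite -(@ler_pXn2r _ 2) ?nnegrE ?frobenius_ge0 //.
by rewrite -subr_ge0 -frobenius_pythagoras // sqr_ge0.
Qed.

(** Both squares are a trace minus the symmetric quantity [\tr (P *m Q)]. *)
Lemma ler_frobenius_proj_swap m (P Q : 'M[R]_m) :
  orthoproj P -> orthoproj Q -> \tr Q <= \tr P ->
  frobenius ((1%:M - P) *m Q) <= frobenius ((1%:M - Q) *m P).
Proof.
move=> Pp Qp trQP; rewrite -(@ler_pXn2r _ 2) ?nnegrE ?frobenius_ge0 //.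
rewrite !frobenius_sqr_proj; try exact: orthoprojC.
case: Pp Qp => [-> ->] [-> ->].
by rewrite !mulmxBl !mul1mx !linearB /= mxtrace_mulC lerD2r.
Qed.

Lemma gram_unitmx m n (G : 'M[R]_(m, n)) :
  row_free G -> G *m G^T \in unitmx.
Proof.
move=> Gfree; rewrite -row_free_unit -kermx_eq0; apply/eqP/row_matrixP => i.
rewrite row0; set u := row i _.
have uG : u *m (G *m G^T) = 0 by apply/sub_kermxP; rewrite row_sub.
have : frobenius (u *m G)^T = 0.
  apply/eqP; rewrite -sqrf_eq0 frobenius_sqr trmxK trmx_mul mulmxA -(mulmxA u).
  by rewrite uG mul0mx mxtrace0.
rewrite frobenius_trmx => /frobenius_eq0 /eqP.
by rewrite mulmx_free_eq0 // => /eqP.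
Qed.

(** A full-rank factorization [B = F G] gives the pseudoinverse
    [G^T (G G^T)^-1 (F^T F)^-1 F^T]; the Gram matrices are invertible because
    the field is real. *)
Lemma pinv_penrose m n (B : 'M[R]_(m, n)) : penrose B (pinv B).
Proof.
suff [X XB] : exists X, penrose B X by apply: (xgetPex 0); exists X.
have [q [F [G [Ffull Gfree ->]]]] : exists q (F : 'M[R]_(m, q)) (G : 'M_(q, n)),
    [/\ row_full F, row_free G & B = F *m G].
  exists (\rank B), (col_base B), (row_base B).
  by split; rewrite ?row_base_free ?col_base_full ?mulmx_base.
have Gu : G *m G^T \in unitmx by rewrite gram_unitmx.
have Fu : F^T *m F \in unitmx.
  have FT : row_free F^T by rewrite /row_free mxrank_tr.
  by have := gram_unitmx FT; rewrite trmxK.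
pose Gp := G^T *m invmx (G *m G^T); pose Fp := invmx (F^T *m F) *m F^T.
have GGp : G *m Gp = 1%:M by rewrite mulmxA mulmxV.
have FpF : Fp *m F = 1%:M by rewrite -mulmxA mulVmx.
have BX : F *m G *m (Gp *m Fp) = F *m Fp.
  by rewrite mulmxA -(mulmxA F) GGp mulmx1.
have XB : Gp *m Fp *m (F *m G) = Gp *m G.
  by rewrite mulmxA -(mulmxA Gp) FpF mulmx1.
exists (Gp *m Fp); split.
- by rewrite BX mulmxA -(mulmxA F) FpF mulmx1.
- by rewrite XB mulmxA -(mulmxA Gp) GGp mulmx1.
- by rewrite BX !trmx_mul trmx_inv trmx_mul !trmxK !mulmxA.
- by rewrite XB !trmx_mul trmx_inv trmx_mul !trmxK !mulmxA.
Qed.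

Lemma pinv_proj m n (B : 'M[R]_(m, n)) : orthoproj (B *m pinv B).
Proof. by have [BXB _ ? _] := pinv_penrose B; split=> //; rewrite mulmxA BXB. Qed.

Lemma pinv_free m n (B : 'M[R]_(m, n)) :
  row_free B^T -> pinv B *m B = 1%:M.
Proof.
have [BXB _ _ _] := pinv_penrose B => Bfree.
apply: trmx_inj; rewrite trmx1; apply: (row_free_inj Bfree).
by rewrite mul1mx -trmx_mul mulmxA BXB.
Qed.

Lemma row_free_colsub_inj m n d (V : 'M[R]_(m, n)) (g : 'I_d -> 'I_n) :
  row_free (colsub g V)^T -> injective g.
Proof.
move=> Cfree a b gab.
have : delta_mx 0 a = delta_mx 0 b :> 'rV[R]_d.
  apply: (row_free_inj Cfree); rewrite -!rowE.
  by apply/rowP => j; rewrite !mxE gab.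
move=> /rowP/(_ a); rewrite !mxE !eqxx /=.
by case: eqP => // _ /eqP; rewrite oner_eq0.
Qed.

Lemma ler_frobenius_colsub m n d (X : 'M[R]_(m, n)) (g : 'I_d -> 'I_n) :
  injective g -> frobenius (colsub g X) <= frobenius X.
Proof.
move=> g_inj; rewrite -(@ler_pXn2r _ 2) ?nnegrE ?frobenius_ge0 //.
rewrite !frobenius_sqr_col.
under eq_bigr do rewrite col_colsub.
have -> : \sum_i frobenius (col (g i) X) ^+ 2 =
    \sum_(j in g @: [set: 'I_d]) frobenius (col j X) ^+ 2.
  rewrite big_imset /=; last by move=> ? ? _ _; apply: g_inj.
  by apply: eq_bigl => i; rewrite finset.in_setT.
rewrite [leRHS](bigID (mem (g @: [set: 'I_d]))) /= lerDl.
by apply: sumr_ge0 => j _; apply: sqr_ge0.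
Qed.

(** The error of selecting [d] independent columns, compared with that of an
    arbitrary orthogonal projector [Q] of rank at most [d]. The part
    [(1 - P) Q V] is turned into [(1 - Q) C C^+], hence into columns of
    [(1 - Q) V], by exchanging the two projectors. *)
Lemma css_projection_error m n d (V : 'M[R]_(m, n)) (g : 'I_d -> 'I_n)
    (Q : 'M[R]_m) :
  let C := colsub g V in
  row_free C^T -> orthoproj Q -> \tr Q <= d%:R ->
  frobenius ((1%:M - C *m pinv C) *m V) <=
    (1 + spectral_norm (pinv C) * spectral_norm V)
      * frobenius ((1%:M - Q) *m V).
Proof.
move=> C Cfree Qp trQ.
have Pp := pinv_proj C; set P := C *m pinv C in Pp *.
have trP : \tr P = d%:R by rewrite mxtrace_mulC pinv_free // mxtrace1.
have -> : (1%:M - P) *m V =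
    (1%:M - P) *m ((1%:M - Q) *m V) + (1%:M - P) *m Q *m V.
  by rewrite -mulmxA -mulmxDr -mulmxDl subrK mul1mx.
apply: le_trans (ler_frobeniusD _ _) _.
rewrite mulrDl mul1r lerD //.
  by apply: ler_frobenius_proj; apply: orthoprojC.
apply: le_trans (ler_frobenius_mulr _ _) _.
rewrite mulrAC ler_wpM2r ?spectral_norm_ge0 //.
apply: le_trans (ler_frobenius_proj_swap Pp Qp _) _; first by rewrite trP.
rewrite mulmxA; apply: le_trans (ler_frobenius_mulr _ _) _.
rewrite mulrC ler_wpM2l ?spectral_norm_ge0 // mulmx_colsub.
by apply: ler_frobenius_colsub; apply: row_free_colsub_inj Cfree.
Qed.

Lemma ler_frobenius_proj_range m n d (P : 'M[R]_m) (C : 'M[R]_(m, d))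
    (V : 'M[R]_(m, n)) :
  orthoproj P -> P *m C = C ->
  frobenius ((1%:M - P) *m V) <= frobenius ((1%:M - C *m pinv C) *m V).
Proof.
move=> Pp PC.
(* 1 - P kills the range of C, so it absorbs the projector 1 - C C^+. *)
have -> : (1%:M - P) *m V = (1%:M - P) *m ((1%:M - C *m pinv C) *m V).
  rewrite mulmxA; congr (_ *m V); rewrite [RHS]mulmxBr mulmx1 mulmxA.
  by rewrite [(1%:M - P) *m C]mulmxBl mul1mx PC subrr mul0mx subr0.
exact/ler_frobenius_proj/orthoprojC.
Qed.

End Projectors.

(** * Leading singular subspaces *)

Section SingularValues.
Context {R : realType}.

(** If the weights are at most [1] and sum to at most [K d], with [1 <= K], then
    moving them to the first [d] entries, each taken [K] times, does not
    decrease the weighted sum of a decreasing sequence. *)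
Lemma ler_capped_weights m d (K : R) (a : nat -> R) (w : 'I_m -> R) :
  (forall i j, (i <= j < m)%N -> 0 <= a j <= a i) ->
  (forall j, 0 <= w j <= 1) -> 1 <= K -> \sum_j w j <= K * d%:R ->
  \sum_(j < m) a j * w j <= K * \sum_(j < m | (j < d)%N) a j.
Proof.
move=> a_anti w01 K1 sum_w.
(* The threshold t lies below a j for j < d and above it for d <= j. *)
pose t := if (d < m)%N then a d else 0.
have t_ge0 : 0 <= t.
  rewrite /t; case: ifP => // dm.
  by have /andP[] : 0 <= a d <= a d by apply: a_anti; rewrite leqnn.
have t_card : t * d%:R = t * \sum_(j < m | (j < d)%N) 1.
  rewrite /t; case: ifP => [dm|]; last by rewrite !mul0r.
  by rewrite -(big_ord_widen m (fun=> 1) (ltnW dm)) sumr_const card_ord.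
apply: (@le_trans _ _
    (\sum_(j < m) (t * w j + if (j < d)%N then K * (a j - t) else 0))).
  apply: ler_sum => j _; have /andP[w0 w1] := w01 j.
  have /andP[a0 _] : 0 <= a j <= a j by apply: a_anti; rewrite leqnn /=.
  case: ltnP => [jd|dj].
    have ta : t <= a j.
      rewrite /t; case: ifP => // dm.
      by have /andP[] : 0 <= a d <= a j by apply: a_anti; rewrite ltnW.
    have : (a j - t) * w j <= (a j - t) * K.
      by rewrite ler_wpM2l ?subr_ge0 ?(le_trans w1).
    lra.
  rewrite addr0 ler_wpM2r // /t (leq_ltn_trans dj) //.
  by have /andP[] : 0 <= a j <= a d by apply: a_anti; rewrite dj /=.
rewrite big_split /= -mulr_sumr -big_mkcond -mulr_sumr /= sumrB.
rewrite [X in _ - X](_ : _ = t * d%:R); last first.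
  by rewrite t_card mulr_sumr; apply: eq_bigr => j _; rewrite mulr1.
by have := ler_wpM2l t_ge0 sum_w; lra.
Qed.

Lemma orthoproj_conj m (P U : 'M[R]_m) :
  U^T *m U = 1%:M -> orthoproj P -> orthoproj (U^T *m P *m U).
Proof.
move=> /mulmx1C UU [PT PP]; split; first by rewrite !trmx_mul trmxK PT mulmxA.
by rewrite !mulmxA -(mulmxA _ U U^T) UU mulmx1 -(mulmxA _ P P) PP.
Qed.

(** With symmetry, idempotence reads [P j j = \sum_l P j l ^+ 2 >= P j j ^+ 2] on the diagonal. *)
Lemma orthoproj_diag01 m (P : 'M[R]_m) j : orthoproj P -> 0 <= P j j <= 1.
Proof.
move=> [PT PP].
have Pjj : P j j = P j j ^+ 2 + \sum_(l | l != j) P j l ^+ 2.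
  rewrite -{1}PP mxE (bigD1 j) //= expr2; congr (_ + _).
  by apply: eq_bigr => l _; rewrite -{2}PT mxE.
have sq_ge0 : 0 <= \sum_(l | l != j) P j l ^+ 2.
  by apply: sumr_ge0 => l _; apply: sqr_ge0.
have P0 : 0 <= P j j by rewrite Pjj addr_ge0 ?sqr_ge0.
rewrite P0 /= leNgt; apply/negP.
by move: (P j j) (\sum_(l | _) _) Pjj sq_ge0 => p q pE q0; nra.
Qed.

(** The eigenvalues of [B B^T] for an [m x n] matrix [B] with singular values
    [s]: when [n < m] the last [m - n] of them vanish, whereas [s] has arbitrary
    values there. *)
Definition sq_sval n (s : nat -> R) (j : nat) : R :=
  if (j < n)%N then s j ^+ 2 else 0.

Definition lead_proj m (U : 'M[R]_m) (d : nat) : 'M[R]_m :=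
  U *m diag_mx (\row_(j < m) (j < d)%N%:R) *m U^T.

(** [|P B|^2 = \tr (P B B^T)], and [B B^T] is diagonal in the basis [U]. *)
Lemma frobenius_sqr_proj_svd m n (B : 'M[R]_(m, n)) U s W (P : 'M[R]_m) :
  is_svd B U s W -> orthoproj P ->
  frobenius (P *m B) ^+ 2 = \sum_(j < m) sq_sval n s j * (U^T *m P *m U) j j.
Proof.
move=> [UU WW _ ->] Pp; rewrite frobenius_sqr_proj //.
have -> : U *m rect_diag m n s *m W^T *m (U *m rect_diag m n s *m W^T)^T
    = U *m diag_mx (\row_(j < m) sq_sval n s j) *m U^T.
  rewrite !trmx_mul trmxK !mulmxA -(mulmxA _ W^T W) WW mulmx1; congr (_ *m _).
  rewrite -mulmxA; congr (_ *m _); apply/matrixP => i j; rewrite !mxE.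
  have -> : \sum_l rect_diag m n s i l * (rect_diag m n s)^T l j =
      \sum_(l < n) if l == i :> nat then s i ^+ 2 *+ (i == j) else 0.
    apply: eq_bigr => l _; rewrite !mxE [i == l :> nat]eq_sym [j == l :> nat]eq_sym.
    case: eqP => [->|_]; rewrite ?mul0r //.
    by rewrite -val_eqE /=; case: eqP => [->|_]; rewrite ?mulr0.
  rewrite -big_mkcond /= /sq_sval; case: ltnP => [i_n|n_i].
    by rewrite (big_pred1 (Ordinal i_n)).
  rewrite mul0rn big_pred0 // => l; apply/eqP => li.
  by move: n_i; rewrite -li leqNgt ltn_ord.
rewrite !mulmxA mxtrace_mulC !mulmxA mul_mx_diag; apply: eq_bigr => j _.
by rewrite [LHS]mxE [X in _ * X]mxE mulrC.
Qed.

Lemma gram_colsub m d (U : 'M[R]_m) (led : (d <= m)%N) :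
  colsub (widen_ord led) U *m (colsub (widen_ord led) U)^T = lead_proj U d.
Proof.
rewrite /lead_proj mul_mx_diag; apply/matrixP => i j; rewrite !mxE.
rewrite [RHS](eq_bigr (fun l : 'I_m => if (l < d)%N then U i l * U j l else 0)).
  rewrite -big_mkcond (big_ord_narrow led) /=.
  by apply: eq_bigr => l _; rewrite !mxE.
by move=> l _; rewrite !mxE; case: ifP => _; rewrite ?mulr1 ?mulr0 ?mul0r.
Qed.

Lemma top_left_sv_proj m n (B : 'M[R]_(m, n)) d (Q : 'M[R]_(m, d)) :
  top_left_sv B Q -> orthoproj (Q *m Q^T) /\ \tr (Q *m Q^T) = d%:R.
Proof.
move=> [U [s [W [led [[UU _ _ _] ->]]]]]; set Q' := colsub _ _.
have QQ : Q'^T *m Q' = 1%:M.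
  apply/matrixP => i j.
  have := congr1 (fun M : 'M_m => M (widen_ord led i) (widen_ord led j)) UU.
  by rewrite !mxE => <-; apply: eq_bigr => l _; rewrite !mxE.
split; last by rewrite mxtrace_mulC QQ mxtrace1.
by split; rewrite ?trmx_mul ?trmxK // mulmxA -(mulmxA Q') QQ mulmx1.
Qed.

Lemma truncated_svd_proj r m n (B Br : 'M[R]_(m, n)) :
  (r <= m)%N -> truncated_svd r B Br ->
  exists2 Q : 'M[R]_(m, r), top_left_sv B Q & Br = Q *m Q^T *m B.
Proof.
move=> ler [U [s [W [svdB ->]]]]; exists (colsub (widen_ord ler) U).
  by exists U, s, W, ler.
have [UU _ _ ->] := svdB.
rewrite gram_colsub /lead_proj !mulmxA -(mulmxA _ U^T U) UU mulmx1.
congr (_ *m _); rewrite -mulmxA; congr (_ *m _); apply/matrixP => i j.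
rewrite mul_diag_mx !mxE; case: eqP => _; last by rewrite mulr0.
by case: ifP => _; rewrite ?mul1r ?mul0r.
Qed.

(** A projector of rank at most [K d] captures at most [K] times the energy of
    [B] captured by its [d] leading left singular vectors. This combines Ky Fan's
    maximum principle (the case [K = 1]) with an averaging over groups of [d]
    singular values. *)
Lemma ler_frobenius_sqr_top m n (B : 'M[R]_(m, n)) d (Q : 'M[R]_(m, d))
    (P : 'M[R]_m) (K : R) :
  top_left_sv B Q -> orthoproj P -> 1 <= K -> \tr P <= K * d%:R ->
  frobenius (P *m B) ^+ 2 <= K * frobenius (Q *m Q^T *m B) ^+ 2.
Proof.
move=> topQ Pp K1 trP; have [Qp _] := top_left_sv_proj topQ.
have [U [s [W [led [svdB defQ]]]]] := topQ.
have [UU _ s_anti _] := svdB; have UU' := mulmx1C UU.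
rewrite !(frobenius_sqr_proj_svd svdB) //.
rewrite [X in K * X](_ : _ = \sum_(j < m | (j < d)%N) sq_sval n s j).
  apply: ler_capped_weights => //.
  - move=> i j /andP[ij jm]; rewrite /sq_sval; case: ltnP => [jn|_].
      have /andP[sj0 sji] : 0 <= s j <= s i.
        by apply: s_anti; rewrite ij leq_min jm.
      by rewrite (leq_ltn_trans ij jn) sqr_ge0 lerXn2r ?nnegrE ?(le_trans sj0).
    by rewrite lexx /=; case: ifP => _; rewrite ?sqr_ge0.
  - by move=> j /=; apply: orthoproj_diag01; apply: orthoproj_conj.
  by rewrite -/(\tr _) mxtrace_mulC mulmxA UU' mul1mx.
rewrite defQ gram_colsub /lead_proj [RHS]big_mkcond /=; apply: eq_bigr => j _.
rewrite !mulmxA UU mul1mx -mulmxA UU mulmx1 !mxE eqxx mulr1n.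
by case: ifP => _; rewrite ?mulr1 ?mulr0.
Qed.

End SingularValues.

(** * Voronoi sets and selected columns *)

Section Voronoi.
Context {R : realType}.

Lemma frobenius_sqr_cols m n (B : 'M[R]_(m, n)) (l : seq 'I_n) :
  frobenius (cols B l) ^+ 2 = \sum_(j <- l) frobenius (col j B) ^+ 2.
Proof.
rewrite frobenius_sqr_col [RHS]big_tnth.
by apply: eq_bigr => j _; rewrite col_colsub.
Qed.

Lemma frobenius_sqr_voronoi m n k p (A : 'M[R]_(m, n)) (f : 'I_n -> 'I_k)
    (X : 'M[R]_(p, m)) :
  \sum_i frobenius (X *m voronoi A f i) ^+ 2 = frobenius (X *m A) ^+ 2.
Proof.
rewrite frobenius_sqr_col (partition_big f xpredT) //=.
apply: eq_bigr => i _; rewrite /voronoi /cols mulmx_colsub frobenius_sqr_cols.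
by rewrite big_enum.
Qed.

Lemma mulmx_pinv_cols m n d (A : 'M[R]_(m, n)) (h : 'I_d -> 'I_n) (l : seq 'I_n) :
  {subset l <= codom h} ->
  let C := colsub h A in C *m pinv C *m cols A l = cols A l.
Proof.
move=> lh C; have [CXC _ _ _] := pinv_penrose C.
apply/matrixP => i j; rewrite /cols.
have /lh/codomP[a ha] : tnth (in_tuple l) j \in l by apply: mem_tnth.
rewrite mulmx_colsub !mxE ha.
by have := congr1 (fun M : 'M_(m, d) => M i a) CXC; rewrite /C mulmx_colsub !mxE.
Qed.

Lemma row_free_colsub_cast m n q q' (e : q = q') (g : 'I_q' -> 'I_n)
    (X : 'M[R]_(m, n)) :
  row_free (colsub (g \o cast_ord e) X)^T = row_free (colsub g X)^T.
Proof.
case: _ / e g => g; congr (row_free _^T).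
by apply: eq_colsub => i /=; rewrite cast_ord_id.
Qed.

Lemma row_free_mulmxl m n p (A : 'M[R]_(m, n)) (B : 'M[R]_(n, p)) :
  row_free (A *m B) -> row_free A.
Proof.
by rewrite -!row_leq_rank => /leq_trans; apply; apply: mxrankM_maxl.
Qed.

Lemma frobenius_sqr_voronoi0 m n k p (A : 'M[R]_(m, n)) (f : 'I_n -> 'I_k)
    (X : 'M[R]_(p, m)) i :
  (forall x, f x != i) -> frobenius (X *m voronoi A f i) ^+ 2 = 0.
Proof.
move=> fi; rewrite mulmx_colsub frobenius_sqr_cols big_enum big_pred0 // => x.
by apply/negbTE; apply: fi.
Qed.

(** [P] is compared with the centroids on each Voronoi set. The sets of the
    discarded indices are empty, so they do not contribute. *)
Lemma ler_voronoi_energy m n k (A : 'M[R]_(m, n)) (f : 'I_n -> 'I_k)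
    (c : centroids R m k) (P : 'M[R]_m) (K : R) :
  are_centroids A f c -> (forall x, (0 < cdim c (f x))%N) ->
  orthoproj P -> 1 <= K ->
  (forall i, (0 < cdim c i)%N -> \tr P <= K * (cdim c i)%:R) ->
  \sum_i frobenius ((1%:M - centroid c i *m (centroid c i)^T)
                      *m voronoi A f i) ^+ 2 <=
    frobenius A ^+ 2 - K^-1 * frobenius (P *m A) ^+ 2.
Proof.
move=> cent covered Pp K1 trP.
have splitA p (X : 'M_(p, m)) := frobenius_sqr_voronoi A f X.
have := splitA _ 1%:M; rewrite mul1mx -[in leRHS](splitA _ P) => <-.
rewrite mulr_sumr -sumrB; apply: ler_sum => i _; rewrite mul1mx.
have [Qp _] := top_left_sv_proj (cent i).
rewrite frobenius_pythagoras // lerD2l lerN2.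
case: (posnP (cdim c i)) => [di|di].
  have fi x : f x != i.
    by apply/eqP => fxi; have := covered x; rewrite fxi di.
  by rewrite !frobenius_sqr_voronoi0 // mulr0.
rewrite mulrC ler_pdivrMr ?(lt_le_trans ltr01) // mulrC.
exact: ler_frobenius_sqr_top (cent i) Pp K1 (trP i di).
Qed.

(** The selector guarantees the independence of [(1 - C_t C_t^+) C_i], where
    [C_t] holds the columns chosen before; it passes to [C_i], since a linear map
    cannot make dependent columns independent. *)
Lemma partitioned_cssp_block (M : col_selector R) m n k r (A : 'M[R]_(m, n))
    (f : 'I_n -> 'I_k) (c : centroids R m k) J (C : 'M[R]_(m, r)) i :
  selects_independent M -> partitioned_cssp M A f c J C -> (0 < cdim c i)%N ->
  [/\ size (J i) = cdim c i, row_free (cols A (J i))^T,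
      exists g, cols A (J i) = colsub g (voronoi A f i) &
      C *m pinv C *m cols A (J i) = cols A (J i)].
Proof.
move=> hM [s [l [_ mem_s _ step [defl ->]]]] di.
have i_s : i \in s by rewrite mem_s.
have [t it] := onthP i_s.
have [dr defJ] := step t i it.
set Vt := _ *m voronoi A f i in dr defJ.
have [cardM freeM] := hM _ _ _ _ dr.
set e := enum _ in defJ freeM.
have sz : size (J i) = size e by rewrite defJ size_map.
(* The size of J i and that of e are equal but not convertible. *)
pose g : 'I_(size (J i)) -> 'I_(size (voronoi_idx f i)) :=
  tnth (in_tuple e) \o cast_ord sz.
have JE : cols A (J i) = colsub g (voronoi A f i).
  rewrite /voronoi /cols -colsub_comp; apply: eq_colsub => a.
  have a_e : (a < size e)%N by rewrite -sz.
  rewrite [LHS](tnth_nth (tnth (in_tuple (voronoi_idx f i)) (g a))) /=.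
  rewrite [LHS](congr1 (fun js => nth _ js a) defJ) (nth_map (g a)) //.
  by congr tnth; rewrite {2}/g /= [RHS](tnth_nth (g a)).
split=> //; first by rewrite sz -cardE.
- rewrite JE -(row_free_colsub_cast sz) in freeM *.
  by move: freeM; rewrite -mulmx_colsub trmx_mul => /row_free_mulmxl.
- by exists g.
apply: mulmx_pinv_cols => x xJ.
have /tnthP[a ->] : x \in l by rewrite memtE defl; apply/flatten_mapP; exists i.
exact: codom_f.
Qed.

Lemma partitioned_cssp_error (M : col_selector R) m n k r (A : 'M[R]_(m, n))
    (f : 'I_n -> 'I_k) (c : centroids R m k) J (C : 'M[R]_(m, r)) i :
  selects_independent M -> partitioned_cssp M A f c J C ->
  are_centroids A f c -> (0 < cdim c i)%N ->
  frobenius ((1%:M - C *m pinv C) *m voronoi A f i) <=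
    (1 + spectral_norm (pinv (cols A (J i))) * spectral_norm (voronoi A f i))
      * frobenius ((1%:M - centroid c i *m (centroid c i)^T)
                     *m voronoi A f i).
Proof.
move=> hM hC cent di.
have [szJ Jfree [g JE] CJ] := partitioned_cssp_block hM hC di.
have [Qp trQ] := top_left_sv_proj (cent i).
apply: le_trans (ler_frobenius_proj_range _ (pinv_proj C) CJ) _.
by move: Jfree; rewrite JE => gfree; apply: css_projection_error; rewrite // trQ szJ.
Qed.

(** Both partitioning algorithms are runs of [iterates_to], and their last
    reassignment only uses indices with a nonempty centroid. *)
Lemma iterates_to_covered m n k (A : 'M[R]_(m, n)) step eps
    (f : 'I_n -> 'I_k) (c : centroids R m k) :
  iterates_to A step eps f c ->
  are_centroids A f c /\ forall x, (0 < cdim c (f x))%N.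
Proof.
move=> [T [fs [cs [steps _ _ -> [dimc cent]]]]]; split=> // x.
by have [_ /(_ x) [d0 _]] := steps T.+1 (ltnSn _); rewrite dimc.
Qed.

End Voronoi.

(** * The error bound *)

Theorem theorem5 (R : realType) (m n rho r k : nat) (A : 'M[R]_(m, n))
    (hrho : \rank A = rho) (hr : (0 < r < rho)%N) (hk : (0 < k < n)%N)
    (M : col_selector R) (hM : selects_independent M)
    (f : 'I_n -> 'I_k) (c : centroids R m k)
    (hout : (exists (d : 'I_k -> nat) (eps : R), cvod_output A r d eps f c) \/
            (exists eps : R, adapt_cvod_output A r eps f c))
    (J : 'I_k -> seq 'I_n) (C : 'M[R]_(m, r))
    (hC : partitioned_cssp M A f c J C)
    (Ar : 'M[R]_(m, n)) (hAr : truncated_svd r A Ar) :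
  let L : R := \big[Num.max/0]_(i | (0 < cdim c i)%N)
                 (Num.ceil (r%:R / (cdim c i)%:R : R))%:~R in
  let zeta : R := \big[Num.max/0]_(i | (0 < cdim c i)%N)
                 (1 + spectral_norm (pinv (cols A (J i))) *
                      spectral_norm (voronoi A f i)) in
  frobenius ((1%:M - C *m pinv C) *m A) <=
    zeta * Num.sqrt (frobenius (A - Ar) ^+ 2
                     + (1 - 1 / L) * frobenius Ar ^+ 2).
Proof.
cbv zeta; set zeta : R := \big[_/_]_(_ | _) _; set L : R := \big[_/_]_(_ | _) _.
have /andP[r0 r_rho] := hr.
have [cent covered] : are_centroids A f c /\ forall x, (0 < cdim c (f x))%N.
  case: hout => [[d [eps [_ _ _]]]|[eps [_]]]; exact: iterates_to_covered.
have L_ge i : (0 < cdim c i)%N -> 1 <= L /\ r%:R <= L * (cdim c i)%:R.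
  move=> di; have d0 : 0 < (cdim c i)%:R :> R by rewrite ltr0n.
  have ceilL : (Num.ceil (r%:R / (cdim c i)%:R : R))%:~R <= L.
    by apply: (bigmax_sup i); rewrite ?lexx.
  split.
    apply: le_trans ceilL; rewrite (ler_int _ 1) -gtz0_ge1 ceil_gt0.
    by rewrite divr_gt0 ?ltr0n.
  rewrite -ler_pdivrMr //; apply: le_trans ceilL; exact: ceil_ge.
have zeta_ge i : (0 < cdim c i)%N ->
    1 + spectral_norm (pinv (cols A (J i))) * spectral_norm (voronoi A f i)
    <= zeta.
  by move=> di; apply: (bigmax_sup i); rewrite ?lexx.
(* A has a column, so at least one index survives and L and zeta are maxima
   over a nonempty set. *)
have x0 : 'I_n by case/andP: hk; case: (n) => // n' _ _; apply: ord0.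
have [L1 _] := L_ge _ (covered x0).
have L0 : 0 < L by apply: lt_le_trans L1.
have zeta0 : 0 <= zeta.
  apply: le_trans (zeta_ge _ (covered x0)).
  by rewrite addr_ge0 ?mulr_ge0 ?spectral_norm_ge0.
have ler : (r <= m)%N.
  by rewrite (leq_trans (ltnW r_rho)) // -hrho rank_leq_row.
have [Q topQ defAr] := truncated_svd_proj ler hAr.
have [Qp trQ] := top_left_sv_proj topQ.
have error : frobenius ((1%:M - C *m pinv C) *m A) ^+ 2 <=
    zeta ^+ 2 * \sum_i frobenius
      ((1%:M - centroid c i *m (centroid c i)^T) *m voronoi A f i) ^+ 2.
  rewrite -(frobenius_sqr_voronoi A f) mulr_sumr; apply: ler_sum => i _.
  case: (posnP (cdim c i)) => [di|di].
    have fi x : f x != i.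
      by apply/eqP => fxi; have := covered x; rewrite fxi di.
    by rewrite !frobenius_sqr_voronoi0 // mulr0.
  rewrite -exprMn ler_pXn2r ?nnegrE ?mulr_ge0 ?frobenius_ge0 //.
  apply: le_trans (partitioned_cssp_error hM hC cent di) _.
  by rewrite ler_wpM2r ?frobenius_ge0 // zeta_ge.
have energy := ler_voronoi_energy cent covered Qp L1.
rewrite trQ -defAr in energy.
have pyth := frobenius_pythagoras A Qp.
rewrite mulmxBl mul1mx -defAr in pyth.
have -> : frobenius (A - Ar) ^+ 2 + (1 - 1 / L) * frobenius Ar ^+ 2 =
    frobenius A ^+ 2 - L^-1 * frobenius Ar ^+ 2.
  by rewrite pyth div1r; ring.
have {}energy := energy (fun i di => (L_ge i di).2).
have bound_ge0 : 0 <= frobenius A ^+ 2 - L^-1 * frobenius Ar ^+ 2.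
  by apply: le_trans energy; apply: sumr_ge0 => i _; apply: sqr_ge0.
have rhs_ge0 := mulr_ge0 zeta0 (sqrtr_ge0
  (frobenius A ^+ 2 - L^-1 * frobenius Ar ^+ 2)).
rewrite -(@ler_pXn2r _ 2) ?nnegrE ?frobenius_ge0 //.
rewrite exprMn (sqr_sqrtr bound_ge0); apply: le_trans error _.
by apply: (ler_wpM2l (sqr_ge0 zeta)).
Qed.
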